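(* Let $\alpha\in(0,1)$ be irrational and let $(q_k)$ be the sequence of denominators of the convergents in the continued fraction expansion of $\alpha$. Let $t,t',u\in S_1=[0,1)$ and let $\varphi_{t,t'}^u:S_1\to\{-1,1\}$ be the function equal to $-1$ on the symmetric difference of the positively oriented arcs $[0,t)$ and $[u,u+t')$ (taken modulo 1) and equal to $1$ elsewhere. If the cocycle $\varphi_{t,t'}^u$ over the rotation by $\alpha$ is not ergodic, then the following four convergences hold simultaneously: \begin{align*} &\lim_k \min\{\|q_k t\|,\ \|q_k u\|,\ \|q_k (t'+u)\|\} = 0,\\ &\lim_k \min\{\|q_k t\|,\ \|q_k (t-u)\|,\ \|q_k (t-t'-u)\|\} = 0,\\ &\lim_k \min\{\|q_k u\|,\ \|q_k (t-u)\|,\ \|q_k t'\|\} = 0,\\ &\lim_k \min\{\|q_k (t'+u)\|,\ \|q_k (t-t'-u)\|,\ \|q_k t'\|\} = 0. \end{align*} In particular, $$\lim_k \min\{\|q_k (t-t')\|,\ \|q_k (t+t')\|\} = 0.$$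
   Context: $S_1=[0,1)$ with $0=1$ is the circle with addition modulo 1 and Lebesgue measure $ds$; $\|s\|=\min(s,1-s)$ for $s\in[0,1)$ is the distance of $s$ to $0$ in $S_1$ (arguments of $\|\cdot\|$ are reduced modulo 1). $\mathbb{Z}_2=\{-1,1\}$ is written multiplicatively, with Haar probability measure $d\kappa$. A cocycle $\varphi:S_1\to\mathbb{Z}_2$ determines the $\mathbb{Z}_2$-extension $T_\varphi(s,\kappa)=(s+\alpha,\kappa\cdot\varphi(s))$ on $S_1\times\mathbb{Z}_2$; $\varphi$ is called ergodic if the product measure $ds\times d\kappa$ is ergodic under $T_\varphi$. Equivalently to the description in the claim, with $\varphi_t=e^{\pi i\mathbf 1_{[0,t)}}$ one has $\varphi_{t,t'}^u(s)=\varphi_t(s)\,\varphi_{t'}(s-u)$. *)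

(* Defs.v *)
From HB Require Import structures.
From mathcomp Require Import all_boot all_order all_algebra.
From mathcomp Require Import all_classical all_reals all_analysis.

Set Implicit Arguments.
Unset Strict Implicit.
Unset Printing Implicit Defensive.

Import Order.TTheory GRing.Theory Num.Theory.
Import numFieldNormedType.Exports.

Local Open Scope classical_set_scope.
Local Open Scope ring_scope.

Section Ergodicity.
Context d (T : measurableType d) (R : realType).
Implicit Types (X : set T) (mu : set T -> \bar R) (f : T -> T).

(* Dynamics on a measurable subset X of an ambient measurable space: f is only
   considered on X, and the events are the measurable subsets of X. *)
Definition measure_preserving X mu f :=
  [/\ {homo f : x / X x}, measurable_fun X f &
      forall A, measurable A -> A `<=` X -> mu (X `&` f @^-1` A) = mu A].

Definition ergodic X mu f :=
  measure_preserving X mu f /\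
  forall A, measurable A -> A `<=` X -> X `&` f @^-1` A = A ->
    mu A = 0%E \/ mu (X `\` A) = 0%E.

End Ergodicity.

Section Circle.
Context (R : realType).
Implicit Types (x s a b alpha t u : R).

Definition frac x : R := x - (Num.floor x)%:~R.

Definition S1 : set R := `[0, 1[%classic.

(* The reduction modulo 1 is built in, so the argument can be any real. *)
Definition dist0 x : R := Num.min (frac x) (1 - frac x).

(* The positively oriented arc [a, b) of the circle, for real lifts a <= b of
   its endpoints. *)
Definition arc a b : set R := frac @` `[a, b[%classic.

(* The two-element group {-1, 1} sits multiplicatively inside R. *)
Definition Z2 : set R := [set -1; 1].

Definition haarZ2 : set R -> \bar R :=
  mscale (2^-1)%:nng (measure_add (dirac (-1 : R)) (dirac (1 : R))).

HB.instance Definition _ := Measure.on haarZ2.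

Lemma haarZ2E A : haarZ2 A = ((2^-1)%:E * (\d_(-1 : R)%R A + \d_(1 : R)%R A))%E.
Proof. by congr (_ * _)%E; exact: measure_addE. Qed.

Lemma haarZ2_setT : haarZ2 setT = 1%E.
Proof. by rewrite haarZ2E !diracT -EFinD -EFinM mulVf. Qed.

HB.instance Definition _ :=
  Measure_isProbability.Build _ _ _ haarZ2 haarZ2_setT.

Definition skew_product alpha (phi : R -> R) (z : R * R) : R * R :=
  (frac (z.1 + alpha), z.2 * phi z.1).

(* measurableTypeR R is R with the Borel sets, the type over which the library
   states lebesgue_measure. *)
Definition ergodic_cocycle alpha (phi : R -> R) :=
  @ergodic _ (measurableTypeR R * measurableTypeR R)%type R (S1 `*` Z2)
    (@lebesgue_measure R \x haarZ2)%E (skew_product alpha phi).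

Definition phi_arcs t t' u s : R :=
  if s \in arc 0 t `+` arc u (u + t') then -1 else 1.

End Circle.

Section ContinuedFraction.
Context (R : realType).
Implicit Types (x : R) (k : nat).

(* x = a_0 + 1/(a_1 + 1/(a_2 + ...)) with a_k the floor of the k-th complete
   quotient; for irrational x no division by 0 occurs. *)
Fixpoint complete_quotient x k : R :=
  if k is k'.+1 then (frac (complete_quotient x k'))^-1 else x.

Definition partial_quotient x k : int := Num.floor (complete_quotient x k).

(* The pair (q_(k-1), q_k), with q_(-1) = 0, q_0 = 1 and
   q_(k+1) = a_(k+1) * q_k + q_(k-1). *)
Fixpoint denom_pair x k : int * int :=
  if k is k'.+1 then
    let: (p, q) := denom_pair x k' in (q, partial_quotient x k * q + p)
  else (0, 1).

Definition convergent_denom x k : int := (denom_pair x k).2.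

End ContinuedFraction.

(* Main.v *)
(* If the skew product is not ergodic, some invariant set has fibres A and B over
   1 and -1 which, by ergodicity of the rotation, are complementary almost
   everywhere. Suppose that a jump p of the cocycle is such that all other jumps y
   satisfy ||q (y - p)|| > e for q = q_k. With h = c / q and N = c q for a small c,
   the translates by j alpha, 0 < |j| <= N, of a neighbourhood of p of radius h are
   then disjoint and contain no jump. The set E of points x at which (A, B) differs
   from its value at x + h therefore has the same measure on [p - h, p) + j alpha
   for all 1 <= j <= N, and likewise for all -N <= j <= 0. Since the cocycle changes
   sign at p, almost every x in [p - h, p) has x or x + alpha in E, so the measure
   of E is at least N h / 2, of order c^2. But that measure tends to 0 with h. *)
Require Import Defs.
From mathcomp Require Import all_boot all_order all_algebra.
From mathcomp Require Import all_classical all_reals all_analysis.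
From mathcomp Require Import measurable_realfun.
From mathcomp Require Import ring lra zify.
Import Order.TTheory GRing.Theory Num.Theory.
Import numFieldNormedType.Exports.
Local Open Scope classical_set_scope.
Local Open Scope ring_scope.

Local Notation frac := Defs.frac.
Local Notation arc := Defs.arc.

(** * Distance to the nearest integer *)

Section Distance.
Context {R : realType}.
Implicit Types (x : R) (n : int).

Lemma frac_ge0 x : 0 <= frac x.
Proof. by rewrite subr_ge0 floor_le. Qed.

Lemma frac_lt1 x : frac x < 1.
Proof. by rewrite ltrBlDr addrC -intrD1 floorD1_gt. Qed.

(** With [dist0_witness], this identifies [dist0] as a minimum over the integers, which turns the
    inequalities below into triangle inequalities for absolute values. *)
Lemma dist0_le x n : dist0 x <= `|x - n%:~R|.
Proof.
rewrite /dist0 /frac ge_min.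
have [nx|xn] := leP n (Num.floor x).
  apply/orP; left; rewrite (le_trans _ (ler_norm _))// lerB// ler_int//.
apply/orP; right; rewrite distrC (le_trans _ (ler_norm _))//.
have : (Num.floor x)%:~R + 1 <= n%:~R :> R by rewrite -intrD1 ler_int lezD1.
by move=> ?; lra.
Qed.

Lemma dist0_witness x : exists n, dist0 x = `|x - n%:~R|.
Proof.
rewrite /dist0 minEle; case: ifP => _.
  by exists (Num.floor x); rewrite ger0_norm// frac_ge0.
exists (Num.floor x + 1); have := frac_lt1 x; rewrite /frac intrD1 => ?.
by rewrite distrC ger0_norm; lra.
Qed.

Lemma dist0_ge0 x : 0 <= dist0 x.
Proof. by have [n ->] := dist0_witness x. Qed.

Lemma dist0N x : dist0 (- x) = dist0 x.
Proof.
apply/eqP; rewrite eq_le; apply/andP; split.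
  have [n ->] := dist0_witness x.
  by rewrite (le_trans (dist0_le _ (- n)))// rmorphN opprK addrC distrC.
have [n ->] := dist0_witness (- x).
by rewrite (le_trans (dist0_le _ (- n)))// rmorphN opprK -normrN opprD.
Qed.

Lemma dist0D x y : dist0 (x + y) <= dist0 x + dist0 y.
Proof.
have [m ->] := dist0_witness x; have [n ->] := dist0_witness y.
rewrite (le_trans (dist0_le _ (m + n)))// rmorphD/= opprD addrACA.
exact: ler_normD.
Qed.

Lemma dist0B x y : dist0 (x - y) <= dist0 x + dist0 y.
Proof. by rewrite -(dist0N y); exact: dist0D. Qed.

End Distance.

(** * Convergents *)

Section Convergents.
Context {R : realType} {alpha : R}.
Hypothesis alpha_irr : irrational alpha.

Lemma irrational_int (q p : int) : q != 0 -> q%:~R * alpha - p%:~R != 0.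
Proof.
move=> q0; apply/negP; rewrite subr_eq0 => /eqP qap; apply: alpha_irr.
exists (p%:Q / q%:Q) => //.
by rewrite rmorph_div/= ?unitfE ?intr_eq0// !ratr_int -qap mulrC mulKf// intr_eq0.
Qed.

(** The numerators [p'] and [p] follow the recurrence of the denominators. Since the partial
    quotient is [f^-1 - frac f^-1], each approximation error is the previous one times a fractional
    part, with opposite sign, and the determinant merely changes sign. *)
Lemma convergent_invariant k :
  let: (q', q) := denom_pair alpha k in
  exists p' p : int,
    [/\ [/\ 0 <= q', (0 < k)%N -> 0 < q', 0 < q & k%:Z <= q],
        q%:~R * alpha - p%:~R =
          - frac (complete_quotient alpha k) * (q'%:~R * alpha - p'%:~R) &
        `|q * p' - q' * p| = 1].
Proof.
elim: k => [|k] /=.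
  exists 1, (Num.floor alpha); split; [by split| |by rewrite mulr1 mul0r subr0].
  by rewrite /frac mul1r mul0r sub0r mulrN1 opprK.
case: (denom_pair alpha k) => q' q [p' [p [[q'0 kq' q0 kq] dE det]]].
set f := frac _ in dE *.
have f0 : f != 0.
  apply: contra_neq (irrational_int q p (lt0r_neq0 q0)) => f0.
  by rewrite dE f0 oppr0 mul0r.
have fgt0 : 0 < f by rewrite lt_neqAle eq_sym f0 frac_ge0.
have a1 : 1 <= partial_quotient alpha k.+1.
  by rewrite /partial_quotient /= floor_ge_int -/f invf_ge1// ltW// frac_lt1.
set a := partial_quotient _ _ in a1 *.
exists p, (a * p + p'); split.
- have : q <= a * q by rewrite ler_peMl// ltW.
  by split=> //; case: (k) kq' kq => [|m] kq' kq; lia.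
- have aE : a%:~R = f^-1 - frac f^-1 by rewrite /frac opprB addrC subrK.
  rewrite !rmorphD !rmorphM/= aE.
  have : f^-1 * (q%:~R * alpha - p%:~R) = - (q'%:~R * alpha - p'%:~R).
    by rewrite dE mulrA mulrN mulVf// mulN1r.
  lra.
- rewrite -det -[RHS]normrN; congr (`|_|); ring.
Qed.

Lemma convergent_denom_gt0 k : 0 < convergent_denom alpha k.
Proof.
have := convergent_invariant k; rewrite /convergent_denom.
by case: denom_pair => q' q [p' [p [[]]]].
Qed.

Lemma convergent_denom_ge k : k%:Z <= convergent_denom alpha k.
Proof.
have := convergent_invariant k; rewrite /convergent_denom.
by case: denom_pair => q' q [p' [p [[]]]].
Qed.

(** The determinant gives both the Bezout coefficients of [p] and [q] and the identity |d'| (q + f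
    q') = 1 for the previous error d'. Hence the current error f |d'| is at most 1 / q. *)
Lemma convergent_approx k : let q := convergent_denom alpha k in
  exists p u v : int, u * p + v * q = 1 /\
    `|q%:~R * alpha - p%:~R| <= q%:~R^-1.
Proof.
have := convergent_invariant k; rewrite /convergent_denom.
case: denom_pair => q' q [p' [p [[q'0 _ q0 _] dE det]]] /=; exists p.
have : q * p' - q' * p = 1 \/ q * p' - q' * p = -1 by lia.
move=> detE.
have Q0 : 0 < q%:~R :> R by rewrite ltr0z.
have [u [v uv]] : exists u v : int, u * p + v * q = 1.
  by case: detE => e; [exists (- q'), p'|exists q', (- p')]; rewrite -?e; lia.
exists u, v; split => //.
set f := frac _ in dE.
have f0 : 0 <= f := frac_ge0 _.
have f1 : f < 1 := frac_lt1 _.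
have Q'0 : 0 <= q'%:~R :> R by rewrite ler0z.
set d' := _ - p'%:~R in dE.
have : `|d'| * (q%:~R + f * q'%:~R) = 1.
  rewrite -[X in _ * X]ger0_norm; last first.
    by rewrite addr_ge0 ?mulr_ge0 // ltW.
  rewrite -normrM.
  have -> : d' * (q%:~R + f * q'%:~R) = - (q * p' - q' * p)%:~R.
    have -> : d' * (q%:~R + f * q'%:~R) =
       q%:~R * d' - q'%:~R * (q%:~R * alpha - p%:~R) by rewrite dE; ring.
    by rewrite /d' rmorphB !rmorphM /=; ring.
  by rewrite normrN -intr_norm det.
move=> d'E.
rewrite dE normrM normrN (ger0_norm f0) -div1r ler_pdivlMr//.
have d0 : 0 <= `|d'| := normr_ge0 _.
have fQ' : 0 <= `|d'| * (f * q'%:~R) by rewrite !mulr_ge0.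
have dQ : 0 <= `|d'| * q%:~R by rewrite mulr_ge0// ltW.
nra.
Qed.

(* With p / q the convergent, j p <> n q as q does not divide j, and j alpha is
   within |j| / q^2 <= 1 / (2 q) of j p / q. *)
Lemma orbit_separation k (j n : int) : let q := convergent_denom alpha k in
  j != 0 -> `|j| *+ 2 <= q -> (q%:~R *+ 2)^-1 <= `|j%:~R * alpha - n%:~R|.
Proof.
move=> /= j0 jq; have := convergent_approx k; have := convergent_denom_gt0 k.
move: (convergent_denom _ _) jq => q jq q0 [p [u [v [uv approx]]]].
have Q0 : 0 < q%:~R :> R by rewrite ltr0z.
have ne : 1 <= `|j * p - n * q|.
  rewrite -gtz0_ge1 normr_gt0; apply: contra_neq j0 => e.
  (* Multiplying the Bezout relation by [j] shows that [q] divides [j], which the bound 2 |j| <= q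
     forbids unless j = 0. *)
  have [w jE] : exists w : int, j = q * w.
    exists (u * n + v * j); rewrite -[LHS]mulr1 -[X in _ * X]uv.
    have -> : j * (u * p + v * q) = u * (j * p - n * q) + q * (u * n + v * j).
      by ring.
    by rewrite e; ring.
  rewrite jE normrM (gtr0_norm q0) in jq.
  have [w0|w0] := eqVneq w 0; last first.
    have : 1 <= `|w| by rewrite -gtz0_ge1 normr_gt0.
    nia.
  by rewrite jE w0 mulr0.
have J : `|j|%:~R *+ 2 <= q%:~R :> R by rewrite -rmorphMn/= ler_int.
rewrite -(ler_pM2l Q0).
have -> : q%:~R * (q%:~R *+ 2)^-1 = 2^-1 :> R.
  by rewrite -[_ *+ 2]mulr_natr invfM mulrA mulfV ?mul1r// gt_eqF.
rewrite -[X in X * `|_|]gtr0_norm// -normrM.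
have -> : q%:~R * (j%:~R * alpha - n%:~R) =
  (j * p - n * q)%:~R + j%:~R * (q%:~R * alpha - p%:~R) :> R.
  by rewrite rmorphB !rmorphM/=; ring.
set y := _ - p%:~R in approx *.
rewrite -[_ * y]opprK; apply: le_trans (lerB_dist _ _).
rewrite normrN normrM -!intr_norm.
have : 1 <= `|j * p - n * q|%:~R :> R by rewrite ler1z.
have : `|j|%:~R * `|y| <= 2^-1.
  rewrite (@le_trans _ _ (`|j|%:~R * q%:~R^-1))// ?ler_wpM2l ?ler0z//.
  rewrite ler_pdivrMr//; lra.
lra.
Qed.

End Convergents.

(** * Periodic sets and the measure of the circle *)

Section TranslationInvariantSets.
Context {R : realType}.
Implicit Types (a b x : R) (F G : set R).

(** An equality of propositions, so that periods can be used for rewriting. *)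
Definition translation_invariant a F := forall x, F (x + a) = F x.

Lemma translation_invariantD a b F : translation_invariant a F ->
  translation_invariant b F -> translation_invariant (a + b) F.
Proof. by move=> Fa Fb x; rewrite addrA Fb Fa. Qed.

Lemma translation_invariantMz a F (n : int) :
  translation_invariant a F -> translation_invariant (n%:~R * a) F.
Proof.
move=> Fa; suff nat_case (k : nat) x : F (x + k%:R * a) = F x.
  case: n => n x; first exact: nat_case.
  by rewrite -(nat_case n.+1) NegzE rmorphN mulNr subrK.
elim: k x => [|k IH] x; first by rewrite mul0r addr0.
by rewrite -natr1 mulrDl mul1r addrA Fa IH.
Qed.

Lemma translation_invariantC a F :
  translation_invariant a F -> translation_invariant a (~` F).
Proof. by move=> Fa x; rewrite /setC /= Fa. Qed.

Lemma translation_invariantI a F G : translation_invariant a F ->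
  translation_invariant a G -> translation_invariant a (F `&` G).
Proof. by move=> Fa Ga x; rewrite /setI /= Fa Ga. Qed.

Lemma translation_invariantU a F G : translation_invariant a F ->
  translation_invariant a G -> translation_invariant a (F `|` G).
Proof. by move=> Fa Ga x; rewrite /setU /= Fa Ga. Qed.

End TranslationInvariantSets.

Section CircleMeasure.
Context {R : realType}.
Local Notation mu := (@lebesgue_measure R).
Implicit Types (a x : R) (A E F G : set R).

Lemma measurable_translation a : measurable_fun setT (fun x : R => x + a).
Proof. by apply: nondecreasing_measurable => // x y xy; rewrite lerD2r. Qed.

Lemma measurable_shift a A : measurable A -> measurable [set x | A (x + a)].
Proof.
move=> mA; rewrite -[X in measurable X]setTI.
exact: (measurable_translation a).
Qed.

Lemma lebesgue_measure_shift a A :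
  measurable A -> mu [set x | A (x + a)] = mu A.
Proof.
move=> mA.
pose f : R -> measurableTypeR R := fun x => x + a.
have mf : measurable_fun setT f by exact: measurable_translation.
suff : pushforward mu f A = mu A by [].
apply/esym/lebesgue_measure_unique => //= _ [[b c]] _ <-.
have -> : pushforward mu f `]b, c]%classic = mu `]b - a, c - a]%classic.
  by congr (mu _); apply/seteqP; split=> x /=; rewrite !in_itv/= ltrBlDr lerBrDr.
by rewrite !lebesgue_measure_itv/= !lte_fin ltrD2r -!EFinB opprB addrA subrK.
Qed.

(* Subsets of the circle are handled as 1-periodic sets of reals, so that
   rotations become honest translations. *)
Definition circle_measure F : R := fine (mu (F `&` `[0, 1[)).
Local Notation cm := circle_measure.

Let muS1 : mu (`[0, 1[ : set R) = 1%E.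
Proof. by rewrite lebesgue_measure_itv/= lte_fin ltr01 oppr0 adde0. Qed.

Lemma circle_measureE F : measurable F -> (cm F)%:E = mu (F `&` `[0, 1[).
Proof.
move=> mF; rewrite fineK// ge0_fin_numE//.
apply: (@le_lt_trans _ _ (mu (`[0, 1[ : set R))); last by rewrite muS1 ltry.
by apply: le_measure; rewrite ?inE//; exact: measurableI.
Qed.

Lemma circle_measure_ge0 F : 0 <= cm F.
Proof. exact/fine_ge0. Qed.

Lemma circle_measure_le F G : measurable F -> measurable G ->
  F `&` `[0, 1[ `<=` G -> cm F <= cm G.
Proof.
move=> mF mG FG; rewrite -lee_fin !circle_measureE//.
apply: le_measure; rewrite ?inE//; try exact: measurableI.
by move=> x [Fx x01]; split => //; apply: FG.
Qed.

Lemma circle_measureU F G : measurable F -> measurable G ->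
  cm (F `|` G) <= cm F + cm G.
Proof.
move=> mF mG; rewrite -lee_fin EFinD !circle_measureE//; last exact: measurableU.
by rewrite setIUl measureU2//; exact: measurableI.
Qed.

Lemma circle_measure_disjointU F G : measurable F -> measurable G ->
  F `&` G = set0 -> cm (F `|` G) = cm F + cm G.
Proof.
move=> mF mG FG; apply: EFin_inj.
rewrite EFinD !circle_measureE//; last exact: measurableU.
rewrite setIUl measureU//; try exact: measurableI.
by rewrite setIACA FG set0I.
Qed.

Lemma circle_measureT : cm setT = 1.
Proof. by rewrite /cm setTI muS1. Qed.

Lemma circle_measure_le1 F : measurable F -> cm F <= 1.
Proof. by move=> mF; rewrite -circle_measureT; apply: circle_measure_le. Qed.

Lemma circle_measureC F : measurable F -> cm (~` F) = 1 - cm F.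
Proof.
move=> mF.
have := circle_measure_disjointU F _ mF (measurableC mF) (setICr F).
by rewrite setUv circle_measureT => ->; rewrite addrAC subrr add0r.
Qed.

Lemma circle_measure_packing E (F : nat -> set R) c n : measurable E ->
  (forall j, (j < n)%N -> measurable (F j)) ->
  (forall i j, (i < j < n)%N -> F i `&` F j = set0) ->
  (forall j, (j < n)%N -> F j `<=` E) ->
  (forall j, (j < n)%N -> cm (F j) = c) -> n%:R * c <= cm E.
Proof.
move=> mE mF dF FE cF.
pose U m := \big[setU/set0]_(j < m) F j.
have UP m x : U m x -> exists2 j, (j < m)%N & F j x.
  elim: m => [|m IH]; rewrite /U ?big_ord0// big_ord_recr/= => -[|Fx].
    by move=> /IH[j jm Fx]; exists j => //; exact: ltnW.
  by exists m.
suff [mU UE] : measurable (U n) /\ cm (U n) = n%:R * c.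
  rewrite -UE; apply: circle_measure_le => // x [/UP[j jn Fx] _].
  exact: (FE j).
have : (n <= n)%N by [].
(* The induction is on m <= n, since the hypotheses concern the fixed [n]. *)
elim: {-2}n => [|m IH] mn.
  rewrite /U big_ord0 mul0r; split => //.
  by rewrite /cm set0I measure0.
have [mU UE] := IH (ltnW mn).
have UF0 : U m `&` F m = set0.
  apply/seteqP; split=> // x [/UP[j jm Fj] Fm].
  by rewrite -(dF j m) ?jm.
have -> : U m.+1 = U m `|` F m by rewrite /U big_ord_recr.
split; first exact: measurableU mU (mF _ mn).
by rewrite (circle_measure_disjointU _ _ mU (mF _ mn) UF0) UE cF// -natr1 mulrDl mul1r.
Qed.

(** An integer translation reduces to [frac a] in place of [a]. The window is then cut at 1, and its
    right piece moved back by 1 completes the left one to [0, 1). *)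
Lemma lebesgue_measure_period F a : measurable F -> translation_invariant 1 F ->
  mu (F `&` `[a, a + 1[) = mu (F `&` `[0, 1[).
Proof.
move=> mF F1.
have mI (b c : R) : measurable (F `&` `[b, c[) by exact: measurableI.
have shift_int (n : int) (b c : R) :
    mu (F `&` `[b + n%:~R, c + n%:~R[) = mu (F `&` `[b, c[).
  have Fn : translation_invariant n%:~R F.
    by rewrite -[n%:~R]mulr1; exact: translation_invariantMz.
  rewrite -(lebesgue_measure_shift n%:~R)//; congr (mu _).
  by apply/seteqP; split=> x /=; rewrite !in_itv/= lerD2r ltrD2r Fn.
have split_itv (b c d : R) : b <= c <= d ->
    mu (F `&` `[b, d[) = (mu (F `&` `[b, c[) + mu (F `&` `[c, d[))%E.
  move=> /andP[bc cd].
  have disj : (F `&` `[b, c[) `&` (F `&` `[c, d[) = set0.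
    by apply/seteqP; split=> // x /=; rewrite !in_itv/=; case=> -[_ ?] [_ ?]; lra.
  rewrite -(measureU mu (mI b c) (mI c d) disj) -setIUr; congr (mu (F `&` _)).
  apply/seteqP; split=> x /=; rewrite !in_itv/=.
    move=> /andP[bx xd]; have [xc|cx] := ltP x c; [left|right];
    by rewrite ?bx ?xc ?cx ?xd.
  by case=> /andP[bx xd]; apply/andP; split; lra.
have a0 := frac_ge0 a; have a1 := frac_lt1 a.
rewrite -(shift_int (- Num.floor a)) rmorphN -/(frac a) addrAC -/(frac a).
have s1 : frac a <= 1 <= frac a + 1 by lra.
have s2 : 0 <= frac a <= 1 by lra.
rewrite (split_itv _ _ _ s1) (split_itv _ _ _ s2).
by rewrite addeC -(shift_int 1 0) add0r.
Qed.

Lemma circle_measure_shift F a : measurable F -> translation_invariant 1 F ->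
  cm [set x | F (x + a)] = cm F.
Proof.
move=> mF F1; apply: EFin_inj; rewrite !circle_measureE//; last exact: measurable_shift.
rewrite -(lebesgue_measure_period F a)//.
rewrite -[RHS](lebesgue_measure_shift a); last exact: measurableI.
congr (mu _); apply/seteqP; split=> x /=; rewrite !in_itv/=.
  by move=> [Fx x01]; split => //; lra.
by move=> [Fx x01]; split => //; lra.
Qed.

End CircleMeasure.

(** * Arcs of the circle as periodic sets *)

Section Arcs.
Context {R : realType}.
Implicit Types (a h x : R).

Lemma measurable_floor : measurable_fun setT (fun x : R => (Num.floor x)%:~R : R).
Proof. by apply: nondecreasing_measurable => // x y xy; rewrite ler_int le_floor. Qed.

Lemma measurable_frac : measurable_fun setT (@Defs.frac R).
Proof. by apply: measurable_funB => //; exact: measurable_floor. Qed.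

Lemma frac_periodic x : frac (x + 1) = frac x.
Proof. by rewrite /frac floorDrz ?rpred1// floor1 rmorphD/= opprD addrACA subrr addr0. Qed.

Lemma frac_id x : 0 <= x < 1 -> frac x = x.
Proof. by move=> x01; rewrite /frac (@floor_def _ x 0) ?subr0. Qed.

(** For 0 <= h <= 1, the lift to the line of the arc [a, a + h). *)
Definition periodic_arc a h : set R := [set x | frac (x - a) < h].

Lemma periodic_arc_invariant a h : translation_invariant 1 (periodic_arc a h).
Proof. by move=> x; rewrite /periodic_arc /= addrAC frac_periodic. Qed.

Lemma measurable_periodic_arc a h : measurable (periodic_arc a h).
Proof.
apply: (measurable_shift (- a) [set x | frac x < h]).
rewrite -[X in measurable X]setTI.
apply: (measurable_frac measurableT `]-oo, h[%classic); exact: measurable_itv.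
Qed.

Lemma circle_measure_arc a h : 0 <= h <= 1 ->
  circle_measure (periodic_arc a h) = h.
Proof.
move=> /andP[h0 h1].
rewrite -(circle_measure_shift _ a); last 2 first.
- exact: measurable_periodic_arc.
- exact: periodic_arc_invariant.
rewrite /circle_measure /periodic_arc /=.
rewrite [X in lebesgue_measure X](_ : _ = `[0, h[%classic); last first.
  apply/seteqP; split=> x /=; rewrite !in_itv/= addrK.
    by move=> [+ x01]; rewrite frac_id//; case/andP: x01 => -> _.
  move=> /andP[x0 xh]; have x01 : 0 <= x < 1 by rewrite x0 (lt_le_trans xh).
  by rewrite frac_id.
rewrite lebesgue_measure_itv/= lte_fin; case: ifPn => [_|].
  by rewrite -EFinB subr0.
by rewrite -leNgt => h0'; apply/eqP; rewrite eq_le h0 h0'.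
Qed.

End Arcs.

(** * Continuity of translation in measure *)

Section Continuity.
Context {R : realType}.
Local Notation mu := (@lebesgue_measure R).
Local Notation cm := circle_measure.
Implicit Types (F K U : set R) (e h x : R).

(** Addition is continuous at each (x, 0), and compactness makes the admissible [h] uniform in
    [x]. *)
Lemma compact_open_translation K U : compact K -> open U -> K `<=` U ->
  exists2 d : R, 0 < d & forall h x, `|h| < d -> K x -> U (x + h).
Proof.
move=> /compact_near_coveringP cK oU KU.
have : \forall h \near (0 : R), K `<=` (fun x => U (x + h)).
  apply: (cK R (nbhs (0 : R)) (fun h x => U (x + h))) => x Kx.
  have cont : (fun z : R * R => z.1 + z.2) @ (x, 0 : R) --> x + 0.
    by apply: cvgD; [exact: cvg_fst|exact: cvg_snd].
  by apply: (cont U); rewrite addr0; apply: open_nbhs_nbhs; split=> //; exact: KU.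
move=> /nbhs_ballP[d /= d0 dU]; exists d => // h x hd Kx.
by apply: (dU h) => //; rewrite /ball/= sub0r normrN.
Qed.

(** The symmetric difference of [F] and F - h. *)
Definition translation_defect h F : set R :=
  (F `\` [set x | F (x + h)]) `|` ([set x | F (x + h)] `\` F).

Lemma measurable_translation_defect h F : measurable F ->
  measurable (translation_defect h F).
Proof.
by move=> mF; apply: measurableU; apply: measurableD => //; exact: measurable_shift.
Qed.

Lemma translation_defect_invariant a h F : translation_invariant a F ->
  translation_invariant a (translation_defect h F).
Proof.
move=> Fa x; rewrite /translation_defect /setU /setD /= -!(addrAC _ h a).
by rewrite !Fa.
Qed.

(** By regularity [F] lies, on a bounded window, between a compact [K] and an open [U] of nearly
    equal measure. For small [h], translation by [h] or -h keeps [K] inside [U], so a point of the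
    defect has [x] or x + h in U minus K. *)
Lemma circle_measure_translation_continuous F e : measurable F ->
    (* The window [0, 2] contains both [x] and x + h when [x] is in [0, 1) and h < 1. *)
    translation_invariant 1 F -> 0 < e ->
  exists2 d : R, 0 < d &
    forall h, 0 <= h < d -> cm (translation_defect h F) <= e.
Proof.
move=> mF F1 e0; pose E := F `&` `[0, 2].
have mE : measurable E by apply: measurableI.
have e4 : 0 < e / 4 by rewrite divr_gt0.
have finE : (mu E < +oo)%E.
  apply: (@le_lt_trans _ _ (mu (`[0, 2] : set R))).
    by apply: le_measure; rewrite ?inE//; exact: subIsetr.
  by rewrite lebesgue_measure_itv/= lte_fin ltr0n oppr0 adde0 ltry.
have [U [oU EU UE]] := lebesgue_regularity_outer mE finE e4.
have [K [cK KE EK]] := lebesgue_regularity_inner mE finE e4.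
have [d d0 dU] := compact_open_translation _ _ cK oU (subset_trans KE EU).
exists (Num.min d 1); first by rewrite lt_min d0 ltr01.
move=> h /andP[h0]; rewrite lt_min => /andP[hd h1].
have mU : measurable (U `\` E) by apply: measurableD => //; exact: open_measurable.
have mK : measurable (E `\` K).
  apply: measurableD => //; apply: closed_measurable.
  by apply: compact_closed => //; exact: Rhausdorff.
have mD := measurable_translation_defect h F mF.
pose V := (E `\` K) `|` (U `\` E).
have mV : measurable V by exact: measurableU.
have VE : (mu V < (e / 2)%:E)%E.
  apply: le_lt_trans; first exact: measureU2.
  by rewrite (_ : e / 2 = e / 4 + e / 4) ?EFinD ?lteD//; field.
rewrite -lee_fin circle_measureE//.
apply: (@le_trans _ _ (mu (V `|` [set x | V (x + h)]))).
  have mVh := measurable_shift h V mV.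
  apply: le_measure; rewrite ?inE; [exact: measurableI|exact: measurableU|].
  move=> x [+ ]; rewrite /= in_itv/= => + /andP[x0 x1].
  have Ex : F x <-> E x by rewrite /E /= in_itv/=; split=> [|[]]//; split=> //; lra.
  have Eh : F (x + h) <-> E (x + h).
    by rewrite /E /= in_itv/=; split=> [|[]]//; split=> //; lra.
  rewrite /translation_defect /V /setU /setD /=.
  have [Kx|Kx] := pselect (K x); have [Kh|Kh] := pselect (K (x + h)).
  - by have := KE _ Kh; have := KE _ Kx; tauto.
  - have Ux : U (x + h) by apply: dU => //; rewrite ger0_norm.
    by have := KE _ Kx; tauto.
  - have : U (x + h - h) by apply: dU => //; rewrite normrN ger0_norm.
    by rewrite addrK; have := KE _ Kh; tauto.
  - tauto.
have VhE : (mu [set x | V (x + h)%R] < (e / 2)%:E)%E.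
  by rewrite lebesgue_measure_shift.
apply: le_trans; first by apply: measureU2 => //; exact: measurable_shift.
rewrite (_ : e = e / 2 + e / 2) ?EFinD; last by field.
by apply: leeD; exact: ltW.
Qed.

End Continuity.

(** * Ergodicity of the irrational rotation *)

Section RotationErgodicity.
Context {R : realType}.
Local Notation mu := (@lebesgue_measure R).
Local Notation cm := circle_measure.
Implicit Types (F : set R) (e x y r : R).

Lemma circle_measure_gt0_density F : measurable F -> 0 < cm F ->
  exists x, exists2 d : R, 0 < d & forall r, 0 < r < d ->
    ((3 / 2 * r)%:E < mu (F `&` ball x r))%E.
Proof.
move=> mF F0.
have [N [mN N0 NF]] := lebesgue_density mF.
have [x [Fx Nx]] : exists x, F x /\ ~ N x.
  apply: contrapT => noF; have : (cm F)%:E = 0%E.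
    apply/eqP; rewrite eq_le; apply/andP; split; last by rewrite lee_fin ltW.
    rewrite circle_measureE// -N0.
    apply: le_measure; rewrite ?inE//; first exact: measurableI.
    by move=> x [Fx _]; apply: contrapT => Nx; apply: noF; exists x.
  by move=> [] F0'; rewrite F0' ltxx in F0.
have : ((mu (F `&` ball x r) * (mu (ball x r))^-1)%E @[r --> 0^'+] --> 1%E).
  by apply: contrapT => nx; apply/Nx/NF => /=; rewrite indicE mem_set.
(* The ball has measure 2 r, so density above 3 / 4 means mass above 3 r / 2. *)
move=> /(_ [set z | ((3 / 4 : R)%:E < z)%E])[].
  by apply: open_ereal_gt'; rewrite lte_fin; lra.
move=> d /= d0 dF; exists x, d => // r /andP[r0 rd].
have := dF r; rewrite /ball_/= sub0r normrN gtr0_norm// => /(_ rd r0).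
rewrite lebesgue_measure_ball ?ltW// inver mulrn_eq0/= gt_eqF//.
rewrite -(@lte_pmul2r _ (r *+ 2)%:E) ?lte_fin ?mulrn_wgt0//.
rewrite -muleA -!EFinM mulVf ?mule1 ?mulrn_eq0 ?gt_eqF//.
by congr (_ < _)%E; congr EFin; lra.
Qed.

Context {alpha : R}.
Hypothesis alpha_irr : irrational alpha.

(** For a convergent p / q, the number q alpha - p is a nonzero period of [F] of size at most 1 / q,
    and one of its integer multiples lies within that distance of [z]. *)
Lemma rotation_orbit_dense F z e : translation_invariant 1 F ->
    translation_invariant alpha F -> 0 < e ->
  exists2 h, translation_invariant h F & `|h - z| < e.
Proof.
move=> F1 Fa e0.
have [k ke] : exists k : nat, (convergent_denom alpha k)%:~R^-1 < e.
  exists (Num.bound e^-1); rewrite -[X in _ < X]invrK ltf_pV2 ?posrE ?invr_gt0//; last first.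
    by rewrite ltr0z; exact: convergent_denom_gt0.
  apply: (lt_le_trans (archi_boundP _)); first by rewrite invr_ge0 ltW.
  by rewrite pmulrn ler_int; exact: convergent_denom_ge.
have [p [_ [_ [_ dk]]]] := convergent_approx alpha_irr k.
have q0 := convergent_denom_gt0 alpha_irr k.
move: (convergent_denom _ _) q0 ke dk => q q0 ke dk.
set d := _ - _ in dk; have d0 : d != 0 by apply: irrational_int => //; rewrite gt_eqF.
exists ((Num.floor (z / d))%:~R * d).
  apply: translation_invariantMz; apply: translation_invariantD.
    exact: translation_invariantMz.
  by rewrite -[p%:~R]mulr1 -mulNr -rmorphN; exact: translation_invariantMz.
rewrite (_ : _ - z = - (frac (z / d) * d)); last by rewrite mulrBl divfK// opprB.
rewrite normrN normrM (ger0_norm (frac_ge0 _)).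
rewrite (le_lt_trans _ (le_lt_trans dk ke))// ler_piMl//.
by rewrite ltW// frac_lt1.
Qed.

(* At density points x of F and y of its complement, an approximate translation
   of x to y leaving F invariant makes F and its complement overlap. *)
Lemma rotation_ergodic F : measurable F -> translation_invariant 1 F ->
  translation_invariant alpha F -> 0 < cm F -> cm F = 1.
Proof.
move=> mF F1 Fa F0; apply/eqP; rewrite eq_le circle_measure_le1//= leNgt.
apply/negP => Flt1; have mC : measurable (~` F) by exact: measurableC.
have [|x [dx dx0 Dx]] := circle_measure_gt0_density F mF; first by [].
have [|y [dy dy0 Dy]] := circle_measure_gt0_density (~` F) mC.
  by rewrite circle_measureC// subr_gt0.
pose r := Num.min dx dy / 2.
have r0 : 0 < r by rewrite divr_gt0// lt_min dx0.
have /andP[rx ry] : (r < dx) && (r < dy).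
  by rewrite -lt_min ltr_pdivrMr// ltr_pMr ?ltr1n// lt_min dx0.
have [|h Fh xhy] := rotation_orbit_dense F (x - y) (r / 4) F1 Fa.
  by rewrite divr_gt0.
(* As [h] is within r / 4 of x - y, translation by -h carries the ball of radius 3 r / 4 about [x]
   into the ball of radius [r] about [y]. *)
have {}Dx : ((9 / 8 * r)%:E < mu (F `&` ball y r))%E.
  apply: (@lt_le_trans _ _ (mu (F `&` ball x (3 / 4 * r)))).
    rewrite (_ : 9 / 8 * r = 3 / 2 * (3 / 4 * r)); last by field.
    by apply: Dx; lra.
  rewrite -[leRHS](lebesgue_measure_shift (- h)); last first.
    by apply: measurableI => //; exact: measurable_ball.
  apply: le_measure; rewrite ?inE.
  - by apply: measurableI => //; exact: measurable_ball.
  - apply: (measurable_shift (- h) (F `&` ball y r)).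
    by apply: measurableI => //; exact: measurable_ball.
  move=> z [Fz]; rewrite /ball/= => zx; split; first by rewrite -Fh subrK.
  rewrite (_ : _ - _ = (x - z) + (h - (x - y))); last by ring.
  apply: le_lt_trans (ler_normD _ _) _; lra.
have mB G : measurable G -> measurable (G `&` ball y r).
  by move=> mG; apply: measurableI => //; exact: measurable_ball.
have : mu (ball y r) = (mu (F `&` ball y r) + mu (~` F `&` ball y r))%E.
  rewrite -measureU; [|exact: mB|exact: mB|].
    by rewrite -setIUl setUv setTI.
  by rewrite setIACA setICr set0I.
rewrite lebesgue_measure_ball ?ltW//; apply/eqP; rewrite lt_eqF//.
(* The two disjoint parts would have total mass above 21 r / 8, but the ball has only 2 r. *)
apply: (@lt_trans _ _ ((9 / 8 * r)%:E + (3 / 2 * r)%:E)%E).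
  by rewrite -EFinD lte_fin; lra.
by apply: lteD => //; apply: Dy; rewrite r0.
Qed.

End RotationErgodicity.

(** * Jumps of a cocycle *)

Section FloorParity.
Context {R : realType}.
Implicit Types (a h x y : R).

(* For points a <= b <= a + 1, the indicator of the arc [a, b) at x is the parity
   of floor (x - a) + floor (x - b), so a union of arcs is encoded symmetrically
   in its endpoints. *)
Definition floor_odd x : bool := odd `|Num.floor x|%N.

Lemma periodic_arcP a h x : periodic_arc a h x ->
  exists (n : int) (f : R), 0 <= f < h /\ x = a + n%:~R + f.
Proof.
move=> xa; exists (Num.floor (x - a)), (frac (x - a)).
by rewrite frac_ge0; split=> //; rewrite /frac; lra.
Qed.

(** If the floor changed, an integer translate of [y] would lie in (x, x + h], hence within [h] of
    an integer translate of [a]. *)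
Lemma floor_odd_stable a h x y : periodic_arc (a - h) h x ->
  (forall n : int, h <= `|y - a - n%:~R|) ->
  floor_odd (x + h - y) = floor_odd (x - y).
Proof.
move=> /periodic_arcP[n [f [/andP[f0 fh] xE]]] far.
congr (odd `|_|%N); apply/eqP; rewrite floor_eq; apply/andP; split.
  by apply: (le_trans (floor_le _)); lra.
rewrite ltNge; apply/negP => le_m.
have lt_m := floorD1_gt (x - y).
move: (Num.floor _ + 1) le_m lt_m => m le_m lt_m.
have := far (n - m); rewrite leNgt rmorphB/= => /negP; apply.
by rewrite ltr_norml; apply/andP; split; lra.
Qed.

(** Going from [x] to x + h crosses exactly one integer translate of [a]. *)
Lemma floor_odd_flip a h x : h <= 1 -> periodic_arc (a - h) h x ->
  floor_odd (x + h - a) = ~~ floor_odd (x - a).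
Proof.
move=> h1 /periodic_arcP[n [f [/andP[f0 fh] xE]]].
rewrite /floor_odd (@floor_def _ (x + h - a) n); last by rewrite intrD1; lra.
rewrite (@floor_def _ (x - a) (n - 1)); last first.
  by rewrite subrK rmorphB rmorph1/=; apply/andP; split; lra.
lia.
Qed.

Lemma floor_oddD1 x : floor_odd (x + 1) = ~~ floor_odd x.
Proof. by rewrite /floor_odd floorDrz ?rpred1// floor1; move: (Num.floor x) => n; lia. Qed.

End FloorParity.

Section Cocycle.
Context {R : realType} {alpha : R}.
Hypothesis alpha_irr : irrational alpha.
Local Notation cm := circle_measure.
Implicit Types (h x : R).

(* A and B are to be the fibres over 1 and -1 of a set invariant under the skew
   product, and phi x means that the cocycle takes the value -1 at x. *)
Variables (p y1 y2 y3 : R) (phi : R -> bool) (A B : set R).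
Hypothesis phiE : forall x, phi x = floor_odd (x - p) (+) floor_odd (x - y1)
  (+) floor_odd (x - y2) (+) floor_odd (x - y3).
Hypotheses (mA : measurable A) (mB : measurable B).
Hypotheses (A1 : translation_invariant 1 A) (B1 : translation_invariant 1 B).
Hypothesis A_step : forall x, A (x + alpha) = if phi x then B x else A x.
Hypothesis B_step : forall x, B (x + alpha) = if phi x then A x else B x.
Hypothesis AB_disjoint : cm [set x | A x <-> B x] = 0.

Let E h := translation_defect h A `|` translation_defect h B.

Let mE h : measurable (E h).
Proof. by apply: measurableU; exact: measurable_translation_defect. Qed.

Let E1 h : translation_invariant 1 (E h).
Proof. by apply: translation_invariantU; exact: translation_defect_invariant. Qed.

(** The pairs (A, B) at [x] and at x + h are both kept or both swapped, so whether they differ does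
    not change. *)
Let E_step h x : phi (x + h) = phi x -> E h (x + alpha) = E h x.
Proof.
move=> phih; rewrite /E /translation_defect /setU /setD /= addrAC.
rewrite !A_step !B_step phih; case: (phi x) => //; apply/propext; tauto.
Qed.

(** Exactly one of the two pairs is swapped. If they agreed both before and after the step, the pair
    at [x] would equal its own swap. *)
Let E_jump h x : phi (x + h) = ~~ phi x -> ~ (A x <-> B x) ->
  E h x \/ E h (x + alpha).
Proof.
move=> phih; rewrite /E /translation_defect /setU /setD /= addrAC.
rewrite !A_step !B_step phih.
have [Ax|Ax] := pselect (A x); have [Bx|Bx] := pselect (B x);
have [Ah|Ah] := pselect (A (x + h)); have [Bh|Bh] := pselect (B (x + h));
case: (phi x) => /=; tauto.
Qed.

Let J h (j : int) := periodic_arc (p + j%:~R * alpha - h) h.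

Let J_step h j x : J h (j + 1) (x + alpha) = J h j x.
Proof.
rewrite /J /periodic_arc /= rmorphD/=; congr (is_true (frac _ < h)); ring.
Qed.

Let D h j := E h `&` J h j.

Let mD h j : measurable (D h j).
Proof. by apply: measurableI => //; exact: measurable_periodic_arc. Qed.

Let D1 h j : translation_invariant 1 (D h j).
Proof. by apply: translation_invariantI => //; exact: periodic_arc_invariant. Qed.

Let mAB : measurable [set x | A x <-> B x].
Proof.
rewrite [X in measurable X](_ : _ = (A `&` B) `|` (~` A `&` ~` B)).
  by apply: measurableU; apply: measurableI => //; exact: measurableC.
by apply/seteqP; split=> x; rewrite /setU /setI /setC /=;
  have [Ax|Ax] := pselect (A x); have [Bx|Bx] := pselect (B x); tauto.
Qed.

(* On the translate of [p - h, p) by j * alpha, phi x and phi (x + h) agree for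
   j <> 0 and differ for j = 0. Hence the measure of E h on these translates is
   constant for 1 <= j <= N and for -N <= j <= 0, while E h or its translate by
   - alpha occupies almost every point of [p - h, p). *)
Lemma jump_separation h (N : nat) : 0 < h <= 1 ->
    (forall y, y \in [:: y1; y2; y3] -> forall j n : int, `|j| <= N%:Z ->
       h <= `|y - p - j%:~R * alpha - n%:~R|) ->
    (forall j n : int, j != 0 -> `|j| <= N%:Z -> h <= `|j%:~R * alpha - n%:~R|) ->
  N%:R * h <= 2 * cm (E h).
Proof.
move=> /andP[h0 h1] far sep.
have stable (j : int) x y : `|j| <= N%:Z -> J h j x -> y \in [:: y1; y2; y3] ->
    floor_odd (x + h - y) = floor_odd (x - y).
  move=> jN Jx yy; apply: (floor_odd_stable (p + j%:~R * alpha)) => // n.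
  by rewrite opprD addrA; exact: far.
have stable_phi (j : int) x : j != 0 -> `|j| <= N%:Z -> J h j x ->
    phi (x + h) = phi x.
  move=> j0 jN Jx; rewrite !phiE (stable j x y1) ?(stable j x y2) ?(stable j x y3)
    ?inE ?eqxx ?orbT//.
  congr (_ (+) _ (+) _ (+) _).
  apply: (floor_odd_stable (p + j%:~R * alpha)) => // n.
  rewrite opprD addrA subrr sub0r -mulNr -rmorphN.
  by apply: sep; rewrite ?oppr_eq0 ?normrN.
have flip_phi x : J h 0 x -> phi (x + h) = ~~ phi x.
  move=> Jx; rewrite !phiE (stable 0 x y1) ?(stable 0 x y2) ?(stable 0 x y3)
    ?inE ?eqxx ?orbT// -!addNb.
  congr (_ (+) _ (+) _ (+) _); apply: floor_odd_flip => //.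
  by move: Jx; rewrite /J mul0r addr0.
have D_step (j : int) : j != 0 -> `|j| <= N%:Z -> cm (D h (j + 1)) = cm (D h j).
  move=> j0 jN; rewrite -(circle_measure_shift (D h (j + 1)) alpha)//.
  congr (cm _); apply/seteqP; split=> x.
    by case; rewrite J_step => + Jx; rewrite E_step//; exact: stable_phi Jx.
  by move=> [Ex Jx]; split; rewrite ?J_step// E_step//; exact: stable_phi Jx.
(* A common point would put (i - j) alpha within [h] of an integer. *)
have D_disjoint (i j : int) : i != j -> `|i - j| <= N%:Z -> D h i `&` D h j = set0.
  move=> ij ijN; apply/seteqP; split=> // x [[_ Ji] [_ Jj]].
  have [n [f [/andP[f0 fh] xE]]] := periodic_arcP _ _ _ Ji.
  have [n' [f' [/andP[f0' fh'] xE']]] := periodic_arcP _ _ _ Jj.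
  have := sep (i - j) (n' - n); rewrite subr_eq0 => /(_ ij ijN).
  rewrite leNgt !rmorphB/= => /negP; apply.
  by rewrite ltr_norml; apply/andP; split; lra.
(* Constancy fails only in the step from index 0 to index 1, so the translates are packed in two
   chains: 1 to N here, then 1 - N to 0. *)
have fwd : N%:R * cm (D h 1) <= cm (E h).
  apply: (circle_measure_packing (E h) (fun j => D h (j.+1)%:Z)) => //.
  - by move=> i j /andP[ij jN]; apply: D_disjoint; lia.
  - by move=> j _ x [].
  - elim=> [//|j IH] jN; rewrite -IH ?(ltnW jN)// -[RHS]D_step; [|lia..].
    by congr (cm (D h _)); lia.
have bwd : N%:R * cm (D h 0) <= cm (E h).
  apply: (circle_measure_packing (E h) (fun j => D h (- j%:Z))) => //.
  - by move=> i j /andP[ij jN]; apply: D_disjoint; lia.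
  - by move=> j _ x [].
  - elim=> [//|j IH] jN; rewrite -IH ?(ltnW jN)// -[LHS]D_step; [|lia..].
    by congr (cm (D h _)); lia.
(* Up to the null set where [A] and [B] agree, [J h 0] is covered by [D h 0] and the translate of
   [D h 1] by - alpha. *)
have : h <= cm (D h 0) + cm (D h 1).
  rewrite -(circle_measure_shift (D h 1) alpha)// -[leRHS]addr0 -AB_disjoint.
  have mD' := measurable_shift alpha (D h 1) (mD h 1).
  rewrite -[leLHS](circle_measure_arc (p + 0%:~R * alpha - h)); last by rewrite ltW.
  apply: le_trans (lerD (circle_measureU _ _ (mD h 0) mD') (lexx _)).
  apply: le_trans (circle_measureU _ _ (measurableU _ _ (mD h 0) mD') mAB).
  apply: circle_measure_le.
  - exact: measurable_periodic_arc.
  - by apply: measurableU => //; exact: measurableU.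
  move=> x [Jx _]; have [AB|AB] := pselect (A x <-> B x); first by right.
  left; have [Ex|Ex] := E_jump h x (flip_phi x Jx) AB; [left|right] => //.
  by split=> //; have : J h (0 + 1) (x + alpha) by rewrite J_step.
have N0 : 0 <= N%:R :> R by [].
nra.
Qed.

Lemma jump_distance_cvg : let q k : R := (convergent_denom alpha k)%:~R in
  Num.min (dist0 (q k * (y1 - p)))
    (Num.min (dist0 (q k * (y2 - p))) (dist0 (q k * (y3 - p)))) @[k --> \oo]
    --> (0 : R).
Proof.
move=> q; apply/cvgrPdist_le => e e0.
(* The bound 2 eta <= e pays for two errors of size eta in the distance to the other jumps; eta <= 1
   / 4 meets the requirements of [orbit_separation]. *)
pose eta : R := Num.min e (1 / 2) / 2.
have min0 : 0 < Num.min e (1 / 2) by rewrite lt_min e0; lra.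
have eta0 : 0 < eta by rewrite divr_gt0.
have min_e : Num.min e (1 / 2) <= e by rewrite ge_min lexx.
have min_half : Num.min e (1 / 2) <= 1 / 2 by rewrite ge_min lexx orbT.
have eta_e : 2 * eta <= e by rewrite /eta; lra.
have eta4 : eta <= 1 / 4 by rewrite /eta; lra.
have g0 : 0 < eta ^+ 2 / 16 by rewrite divr_gt0// exprn_gt0.
have [dA dA0 DA] := circle_measure_translation_continuous A _ mA A1 g0.
have [dB dB0 DB] := circle_measure_translation_continuous B _ mB B1 g0.
(* The constants are such that, for large q, h = eta / q and N <= eta * q give
   N * h > eta ^ 2 / 4, which exceeds twice the measure of the defect. *)
near=> k.
have kA : eta / dA < k%:R by near: k; exact: nbhs_infty_gtr.
have kB : eta / dB < k%:R by near: k; exact: nbhs_infty_gtr.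
have k2 : 2 / eta < k%:R by near: k; exact: nbhs_infty_gtr.
have kq : k%:R <= q k.
  by rewrite /q pmulrn ler_int; exact: convergent_denom_ge.
have q0 : 0 < q k by rewrite ltr0z; exact: convergent_denom_gt0.
rewrite sub0r normrN ger0_norm; last first.
  by rewrite le_min dist0_ge0 le_min !dist0_ge0.
rewrite leNgt; apply/negP; rewrite lt_min => /andP[e1].
rewrite lt_min => /andP[e2 e3].
have far y : y \in [:: y1; y2; y3] -> e < dist0 (q k * (y - p)).
  by rewrite !inE => /or3P[] /eqP ->.
pose h := eta / q k; pose N := Num.truncn (eta * q k).
have h0 : 0 < h by rewrite divr_gt0.
have hq : h * q k = eta by rewrite divfK// gt_eqF.
have hA : h < dA.
  rewrite ltr_pdivrMr// mulrC -ltr_pdivrMr//; exact: lt_le_trans kq.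
have hB : h < dB.
  rewrite ltr_pdivrMr// mulrC -ltr_pdivrMr//; exact: lt_le_trans kq.
have eq2 : 2 < eta * q k.
  by rewrite mulrC -ltr_pdivrMr//; exact: lt_le_trans kq.
have /andP[N1 N2] : N%:R <= eta * q k < N.+1%:R.
  by apply: truncn_itv; rewrite mulr_ge0// ltW.
have [P [_ [_ [_ approx]]]] := convergent_approx alpha_irr k.
rewrite -/(q k) in approx.
have jN_real (j : int) : `|j| <= N%:Z -> `|j%:~R| <= eta * q k.
  by move=> jN; rewrite (le_trans _ N1)// -intr_norm [leRHS]pmulrn ler_int.
have h1 : 0 < h <= 1 by rewrite h0; nra.
have cmE : cm (E h) <= eta ^+ 2 / 8.
  have := DA h; have := DB h; rewrite (ltW h0) hA hB => /(_ isT) cB /(_ isT) cA.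
  apply: le_trans (circle_measureU _ _ _ _) _;
    try exact: measurable_translation_defect.
  lra.
rewrite -natr1 in N2.
(* Since eta q > 2, rounding down leaves [N] above eta q / 2. *)
have Nh : 2 * cm (E h) < N%:R * h.
  have : eta * q k * h = eta ^+ 2 by rewrite -mulrA [q k * h]mulrC hq.
  nra.
move: Nh; apply/negP; rewrite -leNgt; apply: jump_separation => //.
(* Multiplied by [q], a distance below [h] becomes one below eta, and replacing j q alpha by j P
   costs at most eta more. So q (y - p) would be within [e] of an integer. *)
- move=> y yy j n jN; rewrite leNgt; apply/negP => small.
  have := far y yy; rewrite ltNge => /negP; apply.
  apply: (le_trans (dist0_le _ (j * P + convergent_denom alpha k * n))).
  rewrite rmorphD !rmorphM/= -/(q k).
  rewrite (_ : _ - _ = q k * (y - p - j%:~R * alpha - n%:~R) +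
    j%:~R * (q k * alpha - P%:~R)); last by ring.
  apply: (le_trans (ler_normD _ _)).
  rewrite !normrM (gtr0_norm q0).
  have : `|j%:~R| * `|q k * alpha - P%:~R| <= eta.
    apply: (@le_trans _ _ ((eta * q k) * (q k)^-1)).
      by apply: ler_pM => //; exact: jN_real.
    by rewrite mulfK// gt_eqF.
  move: (`|_ - n%:~R|) small => s small; nra.
- move=> j n j0 jN; apply: le_trans (orbit_separation alpha_irr k j n j0 _).
    rewrite -/(q k) -[q k *+ 2]mulr_natr invfM /h mulrC ler_wpM2l ?invr_ge0 ?ltW//.
    lra.
  rewrite -(ler_int R) rmorphMn/= intr_norm -/(q k).
  have := jN_real j jN; nra.
Unshelve. all: by end_near. Qed.

End Cocycle.

(** * The skew product *)

Section ArcIndicator.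
Context {R : realType}.
Implicit Types (a b s t u x : R).

Lemma S1E x : S1 x = (0 <= x < 1) :> Prop.
Proof. by rewrite /S1 /= in_itv. Qed.

Lemma S1_frac x : S1 (frac x).
Proof. by rewrite S1E frac_ge0 frac_lt1. Qed.

Lemma fracDz x (n : int) : frac (x + n%:~R) = frac x.
Proof. by rewrite /frac floorDrz ?intr_int// intrKfloor rmorphD/= opprD addrACA subrr addr0. Qed.

Lemma arcE a b : b - a <= 1 -> arc a b = @S1 R `&` periodic_arc a (b - a).
Proof.
move=> ba1; apply/seteqP; split=> [_ [y + <-]|s [S1s sa]].
  rewrite /= in_itv/= => yab; split; first exact: S1_frac.
  rewrite /periodic_arc /= {2}/Defs.frac addrAC -rmorphN fracDz frac_id ?ltrD2r; lra.
(* This is the lift of [s] to [a, a + 1). *)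
exists (s - (Num.floor (s - a))%:~R).
  move: sa; rewrite /periodic_arc /= in_itv/= => sa.
  by have := frac_ge0 (s - a); move: sa; rewrite /frac; lra.
by rewrite -rmorphN fracDz frac_id// -S1E.
Qed.

(** The two floors differ by 1 on the arc and coincide off it. *)
Lemma periodic_arc_floor a h x : 0 <= h <= 1 ->
  (frac (x - a) < h) = floor_odd (x - a) (+) floor_odd (x - (a + h)).
Proof.
move=> h01; rewrite /floor_odd.
have := frac_ge0 (x - a); have := frac_lt1 (x - a); rewrite /frac.
set m := Num.floor (x - a) => f1 f0; case: ltP => fh.
  rewrite (@floor_def _ (x - (a + h)) (m - 1)); last first.
    by rewrite subrK rmorphB rmorph1/=; apply/andP; split; lra.
  by move: (m) => n; lia.
rewrite (@floor_def _ (x - (a + h)) m) ?addbb//.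
by rewrite intrD1; apply/andP; split; lra.
Qed.

(** Each arc contributes its two endpoints and [(+)] realises the symmetric difference, so the four
    jumps 0, t, u and t' + u play the same role. *)
Definition arcs_parity t t' u x : bool := floor_odd x (+) floor_odd (x - t)
  (+) floor_odd (x - u) (+) floor_odd (x - (t' + u)).

Lemma arcs_parityD1 t t' u x : arcs_parity t t' u (x + 1) = arcs_parity t t' u x.
Proof.
rewrite /arcs_parity !(addrAC x 1) !floor_oddD1.
by do 4!case: floor_odd.
Qed.

Lemma arcs_parity_arcs t t' u x : 0 <= t <= 1 -> 0 <= t' <= 1 ->
  arcs_parity t t' u x = (frac (x - 0) < t) (+) (frac (x - u) < t').
Proof.
move=> t01 t'01; rewrite !periodic_arc_floor// subr0 add0r (addrC u).
by rewrite /arcs_parity -!addbA.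
Qed.

Lemma phi_arcs_parity t t' u s : S1 t -> S1 t' -> S1 s ->
  phi_arcs t t' u s = if arcs_parity t t' u s then -1 else 1.
Proof.
move=> + + S1s; rewrite !S1E => /andP[t0 t1] /andP[t'0 t'1].
rewrite /phi_arcs arcs_parity_arcs ?t0 ?t'0 ?ltW//; congr (if _ then _ else _).
have arc_t : arc 0 t s <-> frac (s - 0) < t.
  by rewrite arcE ?subr0 ?ltW// /periodic_arc /setI /= subr0; tauto.
have arc_t' : arc u (u + t') s <-> frac (s - u) < t'.
  rewrite arcE; last by lra.
  by rewrite [u + t']addrC addrK /periodic_arc /setI /=; tauto.
by apply/idP/idP; rewrite inE /setY /setU /setD /= arc_t arc_t';
  case: (_ < t); case: (_ < t') => //=; intuition.
Qed.

Lemma measurable_arcs_parity t t' u : S1 t -> S1 t' ->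
  measurable [set x | arcs_parity t t' u x].
Proof.
rewrite !S1E => /andP[t0 t1] /andP[t'0 t'1].
rewrite (_ : [set x | _] = periodic_arc 0 t `+` periodic_arc u t').
  by apply: measurableU; apply: measurableD; exact: measurable_periodic_arc.
apply/seteqP; split=> x; rewrite /setY /periodic_arc /setU /setD /=;
  rewrite arcs_parity_arcs ?t0 ?t'0 ?ltW//;
  by case: (_ < t); case: (_ < t') => //=; intuition.
Qed.

End ArcIndicator.

(** * Fibres of sets invariant under the skew product *)

Section SkewProduct.
Context {R : realType}.
Local Notation mu := (@lebesgue_measure R).
Local Notation cm := circle_measure.
Local Notation RR := (measurableTypeR R * measurableTypeR R)%type.
Local Notation nu := (@lebesgue_measure R \x @haarZ2 R)%E.
Implicit Types (C : set RR) (s x k : R).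

Definition periodic_section C k : set R := [set x | C (frac x, k)].

Lemma periodic_section_invariant C k : translation_invariant 1 (periodic_section C k).
Proof. by move=> x; rewrite /periodic_section /= frac_periodic. Qed.

Lemma measurable_periodic_section C k : measurable C ->
  measurable (periodic_section C k).
Proof.
move=> mC; have -> : periodic_section C k = @Defs.frac R @^-1` ysection C k.
  by apply/seteqP; split=> x /ysectionP.
rewrite -[X in measurable X]setTI.
by apply: measurable_frac => //; exact: measurable_ysection.
Qed.

(** The Haar measure of a vertical section is half the sum of the indicators of the two horizontal
    fibres, which is then integrated over the circle. *)
Lemma product_haarZ2E C : measurable C -> C `<=` @S1 R `*` @Z2 R ->
  nu C = ((cm (periodic_section C 1) + cm (periodic_section C (-1))) / 2)%:E.
Proof.
move=> mC CX.
have secE k : mu (ysection C k) = (cm (periodic_section C k))%:E.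
  rewrite circle_measureE; last exact: measurable_periodic_section.
  congr (mu _); apply/seteqP; split=> x.
    move=> /ysectionP Cx; have [/= x01 _] := CX _ Cx.
    split; first by rewrite /periodic_section/= frac_id// -S1E.
    exact: x01.
  move=> [+ x01]; rewrite /periodic_section/= frac_id; first by move=> /ysectionP.
  by move: x01; rewrite /= in_itv.
rewrite /product_measure1 /=.
under eq_integral.
  move=> x _; rewrite haarZ2E !diracE !mem_xsection -!mem_ysection -!indicE.
  over.
have mi k : measurable_fun setT (fun x => (\1_(ysection C k) x)%:E : \bar R).
  by apply/measurable_EFinP; apply: measurable_indic; exact: measurable_ysection.
rewrite ge0_integralZl//; last 2 first.
- by apply: (emeasurable_funD (mi (-1)) (mi 1)).
- by move=> x _; rewrite adde_ge0// lee_fin.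
rewrite ge0_integralD//; last 2 first.
- exact: mi.
- exact: mi.
rewrite !integral_indic ?setIT//; try exact: measurable_ysection.
transitivity (2^-1%:E * ((cm (periodic_section C (-1)))%:E +
                         (cm (periodic_section C 1))%:E))%E.
  by congr (_ * (_ + _))%E; exact: secE.
by rewrite -EFinD -EFinM; congr EFin; lra.
Qed.

Context {alpha : R} {phi : R -> R} {b : R -> bool}.
Hypothesis b1 : forall x, b (x + 1) = b x.
Hypothesis mb : measurable [set x | b x].
Hypothesis mphi : measurable_fun setT phi.
Hypothesis phiE : forall s, S1 s -> phi s = if b s then -1 else 1.
Local Notation T := (skew_product alpha phi).
Local Notation X := (@S1 R `*` @Z2 R).

Let b_frac x : b (frac x) = b x.
Proof.
(* Period 1 extends to all integers by viewing a level set of [b] as a translation-invariant set. *)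
have bz (y : R) (n : int) : [set z | b z = b y] (y + n%:~R * 1).
  rewrite (translation_invariantMz _ _ n) //= => z /=; by rewrite b1.
by have := bz x (- Num.floor x); rewrite mulr1 rmorphN.
Qed.

Let preserves_X z : X z -> X (T z).
Proof.
move=> [/= s01 Zz]; split => /=; first exact: S1_frac.
rewrite phiE//; case: Zz => ->; case: (b _); rewrite /Z2 /= ?mulN1r ?opprK ?mul1r;
  by [left|right].
Qed.

Let X_frac x k : k = 1 \/ k = -1 -> X (frac x, k).
Proof. by move=> kZ; split; [exact: S1_frac|case: kZ => ->; [right|left]]. Qed.

Let section_preimage C k : k = 1 \/ k = -1 ->
  periodic_section (X `&` T @^-1` C) k =
  [set x | if b x then periodic_section C (- k) (x + alpha)
           else periodic_section C k (x + alpha)].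
Proof.
move=> kZ.
have fracDl x : frac (frac x + alpha) = frac (x + alpha).
  by rewrite {2}/Defs.frac addrAC -rmorphN fracDz.
apply/seteqP; split=> x; rewrite /periodic_section /= /skew_product /= fracDl;
  rewrite phiE ?b_frac; try exact: S1_frac; case: (b x); rewrite ?mulrN1 ?mulr1.
- by case.
- by case.
- by move=> Cx; split=> //; exact: X_frac.
- by move=> Cx; split=> //; exact: X_frac.
Qed.

Let measurable_skew_product : measurable_fun X (T : RR -> RR).
Proof.
apply: measurable_funTS; apply: measurable_fun_pair.
  apply: (measurableT_comp measurable_frac).
  by apply: (measurableT_comp (measurable_translation alpha)).
apply: measurable_funM => //.
exact: (measurableT_comp mphi).
Qed.

Lemma measurable_S1xZ2 : measurable (X : set RR).
Proof.
apply: measurableX; first exact: measurable_itv.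
by apply: measurableU.
Qed.

(** The preimage rotates both fibres and exchanges them over the set where [b] holds. Cutting along
    that set shows that the sum of the two measures is unchanged. *)
Lemma skew_product_measure_preserving :
  @measure_preserving _ RR R X nu T.
Proof.
split=> [|//|C mC CX]; first exact: preserves_X.
have mTC : measurable (X `&` T @^-1` C : set RR).
  by apply: measurable_skew_product => //; exact: measurable_S1xZ2.
rewrite (product_haarZ2E _ mC CX) (product_haarZ2E _ mTC); last exact: subIsetl.
rewrite (section_preimage _ 1); last by left.
rewrite (section_preimage _ (-1)); last by right.
rewrite opprK; congr ((_ / 2)%:E).
set Cp := periodic_section C 1; set Cm := periodic_section C (-1).
have shift k := circle_measure_shift _ alpha (measurable_periodic_section C k mC)
  (periodic_section_invariant C k).
rewrite -(shift 1) -(shift (-1)) -/Cp -/Cm.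
have mp : measurable [set x | Cp (x + alpha)].
  by apply: measurable_shift; exact: measurable_periodic_section.
have mm : measurable [set x | Cm (x + alpha)].
  by apply: measurable_shift; exact: measurable_periodic_section.
have split_b F : measurable F -> cm F = cm (F `&` [set x | b x]) + cm (F `\` [set x | b x]).
  move=> mF; rewrite -circle_measure_disjointU.
  - by rewrite setUIDK.
  - exact: measurableI.
  - exact: measurableD.
  - by rewrite setDE setIACA setICr setI0.
have mif F G : measurable F -> measurable G ->
    measurable [set x | if b x then F x else G x].
  move=> mF mG.
  rewrite (_ : [set x | _] = (F `&` [set x | b x]) `|` (G `\` [set x | b x])).
    by apply: measurableU; [exact: measurableI|exact: measurableD].
  by apply/seteqP; split=> x; rewrite /setU /setI /setD /=; case: (b x);
    have tt : true by []; have ff : ~ false by []; tauto.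
rewrite (split_b _ (mif _ _ mm mp)) (split_b _ (mif _ _ mp mm)).
rewrite (split_b _ mm) (split_b _ mp).
have ifI F G : [set x | if b x then F x else G x] `&` [set x | b x] = F `&` [set x | b x].
  by apply/seteqP; split=> x; rewrite /setI /=; case: (b x);
    have tt : true by []; have ff : ~ false by []; tauto.
have ifD F G : [set x | if b x then F x else G x] `\` [set x | b x] = G `\` [set x | b x].
  by apply/seteqP; split=> x; rewrite /setD /=; case: (b x);
    have tt : true by []; have ff : ~ false by []; tauto.
rewrite !ifI !ifD; lra.
Qed.

(** For the fibres of an invariant set, both the intersection and the intersection of the
    complements are rotation-invariant, as swapping [A] and [B] preserves them. If either has
    positive measure it is full, so the invariant set is conull or null. Otherwise [A] and [B] are
    complementary almost everywhere. *)
Lemma nonergodic_sections : irrational alpha -> ~ @ergodic _ RR R X nu T ->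
  exists A B : set R, [/\ measurable A, measurable B,
    translation_invariant 1 A, translation_invariant 1 B &
    [/\ forall x, A (x + alpha) = if b x then B x else A x,
        forall x, B (x + alpha) = if b x then A x else B x &
        cm [set x | A x <-> B x] = 0]].
Proof.
move=> alpha_irr nonerg; apply: contrapT => noAB; apply: nonerg.
split=> [|C mC CX CT]; first exact: skew_product_measure_preserving.
pose A := periodic_section C 1; pose B := periodic_section C (-1).
have mA : measurable A by exact: measurable_periodic_section.
have mB : measurable B by exact: measurable_periodic_section.
have A1 : translation_invariant 1 A by exact: periodic_section_invariant.
have B1 : translation_invariant 1 B by exact: periodic_section_invariant.
have AE x : A x = if b x then B (x + alpha) else A (x + alpha).
  by rewrite {1}/A -CT section_preimage//; left.
have BE x : B x = if b x then A (x + alpha) else B (x + alpha).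
  by rewrite {1}/B -CT section_preimage ?opprK//; right.
have A_step x : A (x + alpha) = if b x then B x else A x.
  by rewrite (AE x) (BE x); case: (b x).
have B_step x : B (x + alpha) = if b x then A x else B x.
  by rewrite (AE x) (BE x); case: (b x).
have nuE : nu C = ((cm A + cm B) / 2)%:E by exact: product_haarZ2E.
have mXC : measurable (X `\` C : set RR).
  by apply: measurableD => //; exact: measurable_S1xZ2.
have sectionC k : k = 1 \/ k = -1 ->
    periodic_section (X `\` C) k = ~` periodic_section C k.
  move=> kZ; apply/seteqP; split=> x; rewrite /periodic_section /setD /setC /=.
    by case.
  by move=> Cx; split=> //; exact: X_frac.
have nuCE : nu (X `\` C) = ((1 - cm A + (1 - cm B)) / 2)%:E.
  rewrite (product_haarZ2E _ mXC); last exact: subDsetl.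
  rewrite (sectionC 1); last by left.
  rewrite (sectionC (-1)); last by right.
  by rewrite !circle_measureC.
have mI : measurable (A `&` B) by exact: measurableI.
have mU : measurable (~` A `&` ~` B) by apply: measurableI; exact: measurableC.
have I1 : translation_invariant 1 (A `&` B) by exact: translation_invariantI.
have U1 : translation_invariant 1 (~` A `&` ~` B).
  by apply: translation_invariantI; exact: translation_invariantC.
have Ia : translation_invariant alpha (A `&` B).
  by move=> x; rewrite /setI /= A_step B_step; case: (b x) => //; rewrite propeqE; tauto.
have Ua : translation_invariant alpha (~` A `&` ~` B).
  move=> x; rewrite /setI /setC /= A_step B_step; case: (b x) => //.
  by rewrite propeqE; tauto.
have := circle_measure_le1 A mA; have := circle_measure_le1 B mB.
have := circle_measure_ge0 A; have := circle_measure_ge0 B.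
move=> B0 A0 Bl1 Al1.
have [I0|I0] := ltP 0 (cm (A `&` B)).
  right; rewrite nuCE; congr EFin.
  have := rotation_ergodic alpha_irr _ mI I1 Ia I0.
  have : cm (A `&` B) <= cm A by apply: circle_measure_le => // x [[]].
  have : cm (A `&` B) <= cm B by apply: circle_measure_le => // x [[]].
  lra.
have [U0|U0] := ltP 0 (cm (~` A `&` ~` B)).
  left; rewrite nuE; congr EFin.
  have := rotation_ergodic alpha_irr _ mU U1 Ua U0.
  have : cm (~` A `&` ~` B) <= cm (~` A).
    by apply: circle_measure_le => // [|x [[]]//]; exact: measurableC.
  have : cm (~` A `&` ~` B) <= cm (~` B).
    by apply: circle_measure_le => // [|x [[]]//]; exact: measurableC.
  rewrite !circle_measureC//; lra.
exfalso; apply: noAB; exists A, B; split=> //; split=> //.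
apply/eqP; rewrite eq_le circle_measure_ge0 andbT.
rewrite [X in cm X](_ : _ = (A `&` B) `|` (~` A `&` ~` B)); last first.
  by apply/seteqP; split=> x; rewrite /setU /setI /setC /=;
    have [Ax|Ax] := pselect (A x); have [Bx|Bx] := pselect (B x); tauto.
by apply: le_trans (circle_measureU _ _ mI mU) _; lra.
Qed.

End SkewProduct.

(** * Combining the four limits *)

(** The six distances are the edges of the complete graph on the jumps 0, x, z, y + z, and each
    minimum picks an edge at one vertex. The chosen edges cover all vertices, so they contain a
    perfect matching or a star with three edges. Either one bounds x - y or x + y. *)
Lemma dist0_min_sum_diff (R : realType) (x y z : R) : let s :=
    Num.min (dist0 x) (Num.min (dist0 z) (dist0 (y + z))) +
    Num.min (dist0 x) (Num.min (dist0 (x - z)) (dist0 (x - y - z))) +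
    Num.min (dist0 z) (Num.min (dist0 (x - z)) (dist0 y)) +
    Num.min (dist0 (y + z)) (Num.min (dist0 (x - y - z)) (dist0 y)) in
  Num.min (dist0 (x - y)) (dist0 (x + y)) <= 3 * s.
Proof.
have : dist0 (x - y) <= dist0 x + dist0 y by exact: dist0B.
have : dist0 (x + y) <= dist0 x + dist0 y by exact: dist0D.
have : dist0 (x - y) <= dist0 z + dist0 (x - y - z).
  by rewrite -{1}(subrKC z (x - y)); exact: dist0D.
have : dist0 (x + y) <= dist0 (y + z) + dist0 (x - z).
  by rewrite (_ : x + y = (y + z) + (x - z)); [exact: dist0D|ring].
(* The inequalities so far treat the matchings; the next four treat the stars at z, y + z, 0 and x,
   in this order. *)
have : dist0 x <= dist0 z + dist0 (x - z).
  by rewrite -{1}(subrKC z x); exact: dist0D.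
have : dist0 x <= dist0 (y + z) + dist0 (x - y - z).
  by rewrite {1}(_ : x = (y + z) + (x - y - z)); [exact: dist0D|ring].
have : dist0 y <= dist0 (y + z) + dist0 z.
  by rewrite -{1}(addrK z y); exact: dist0B.
have : dist0 y <= dist0 (x - z) + dist0 (x - y - z).
  by rewrite {1}(_ : y = (x - z) - (x - y - z)); [exact: dist0B|ring].
have : Num.min (dist0 (x - y)) (dist0 (x + y)) <= dist0 (x - y).
  by rewrite ge_min lexx.
have : Num.min (dist0 (x - y)) (dist0 (x + y)) <= dist0 (x + y).
  by rewrite ge_min lexx orbT.
have := dist0_ge0 x; have := dist0_ge0 y; have := dist0_ge0 z.
have := dist0_ge0 (y + z); have := dist0_ge0 (x - z); have := dist0_ge0 (x - y - z).
move: (dist0 x) (dist0 y) (dist0 z) (dist0 (y + z)) (dist0 (x - z))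
  (dist0 (x - y - z)) (dist0 (x - y)) (dist0 (x + y)) (Num.min _ (dist0 (x + y))).
move=> a f b c d e xy xy' m *.
rewrite /= ![in X in _ <= X]minEle.
repeat case: ifP => _; lra.
Qed.

Lemma measurable_phi_arcs (R : realType) (t t' u : R) : S1 t -> S1 t' ->
  measurable_fun setT (phi_arcs t t' u).
Proof.
move=> tS1 t'S1.
have m_arc (a b : R) : b - a <= 1 -> measurable (arc a b).
  move=> ba; rewrite arcE//; apply: measurableI; first exact: measurable_itv.
  exact: measurable_periodic_arc.
have m_arcs : measurable (arc 0 t `+` arc u (u + t')).
  move: tS1 t'S1; rewrite !S1E => t01 t'01.
  by apply: measurableU; apply: measurableD; apply: m_arc; lra.
rewrite (_ : phi_arcs t t' u = fun s => 1 - 2 * \1_(arc 0 t `+` arc u (u + t')) s).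
  by apply: measurable_funB => //; apply: measurable_funM.
by apply/funext => s; rewrite /phi_arcs indicE; case: (s \in _) => /=; lra.
Qed.

Theorem theorem6p2 (R : realType) (alpha t t' u : R)
    (alpha01 : 0 < alpha < 1) (alpha_irr : irrational alpha)
    (tS1 : S1 t) (t'S1 : S1 t') (uS1 : S1 u)
    (nonerg : ~ ergodic_cocycle alpha (phi_arcs t t' u)) :
  let q (k : nat) : R := (convergent_denom alpha k)%:~R in
  [/\ Num.min (dist0 (q k * t))
        (Num.min (dist0 (q k * u)) (dist0 (q k * (t' + u)))) @[k --> \oo]
        --> (0 : R),
      Num.min (dist0 (q k * t))
        (Num.min (dist0 (q k * (t - u))) (dist0 (q k * (t - t' - u))))
        @[k --> \oo] --> (0 : R),
      Num.min (dist0 (q k * u))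
        (Num.min (dist0 (q k * (t - u))) (dist0 (q k * t'))) @[k --> \oo]
        --> (0 : R),
      Num.min (dist0 (q k * (t' + u)))
        (Num.min (dist0 (q k * (t - t' - u))) (dist0 (q k * t')))
        @[k --> \oo] --> (0 : R) &
      Num.min (dist0 (q k * (t - t'))) (dist0 (q k * (t + t')))
        @[k --> \oo] --> (0 : R)].
Proof.
move=> q.
have [A [B [mA mB A1 B1 [A_step B_step AB0]]]] :=
  nonergodic_sections (arcs_parityD1 t t' u) (measurable_arcs_parity t t' u tS1 t'S1)
    (measurable_phi_arcs _ t t' u tS1 t'S1)
    (fun s => phi_arcs_parity t t' u s tS1 t'S1) alpha_irr nonerg.
(* Each of the four jumps serves in turn as [p]; reordering the parity sum provides [phiE]. *)
have jump p y1 y2 y3 (phiE : forall x, arcs_parity t t' u x =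
    floor_odd (x - p) (+) floor_odd (x - y1) (+) floor_odd (x - y2)
    (+) floor_odd (x - y3)) :=
  jump_distance_cvg alpha_irr _ _ _ _ _ _ _ phiE mA mB A1 B1 A_step B_step AB0.
pose m1 k := Num.min (dist0 (q k * t))
  (Num.min (dist0 (q k * u)) (dist0 (q k * (t' + u)))).
pose m2 k := Num.min (dist0 (q k * t))
  (Num.min (dist0 (q k * (t - u))) (dist0 (q k * (t - t' - u)))).
pose m3 k := Num.min (dist0 (q k * u))
  (Num.min (dist0 (q k * (t - u))) (dist0 (q k * t'))).
pose m4 k := Num.min (dist0 (q k * (t' + u)))
  (Num.min (dist0 (q k * (t - t' - u))) (dist0 (q k * t'))).
have flip k x y : y = - x -> dist0 (q k * x) = dist0 (q k * y).
  by move=> ->; rewrite mulrN dist0N.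
have c1 : m1 k @[k --> \oo] --> (0 : R).
  rewrite (_ : m1 = fun k => Num.min (dist0 (q k * (t - 0)))
    (Num.min (dist0 (q k * (u - 0))) (dist0 (q k * (t' + u - 0))))).
    by apply: jump => x; rewrite subr0.
  by apply/funext => k; rewrite !subr0.
have c2 : m2 k @[k --> \oo] --> (0 : R).
  rewrite (_ : m2 = fun k => Num.min (dist0 (q k * (0 - t)))
    (Num.min (dist0 (q k * (u - t))) (dist0 (q k * (t' + u - t))))).
    by apply: jump => x; rewrite subr0 /arcs_parity; do 4!case: floor_odd.
  by apply/funext => k; congr (Num.min _ (Num.min _ _)); apply: flip; ring.
have c3 : m3 k @[k --> \oo] --> (0 : R).
  rewrite (_ : m3 = fun k => Num.min (dist0 (q k * (0 - u)))
    (Num.min (dist0 (q k * (t - u))) (dist0 (q k * (t' + u - u))))).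
    by apply: jump => x; rewrite subr0 /arcs_parity; do 4!case: floor_odd.
  apply/funext => k; rewrite addrK; congr (Num.min _ _).
  by apply: flip; ring.
have c4 : m4 k @[k --> \oo] --> (0 : R).
  rewrite (_ : m4 = fun k => Num.min (dist0 (q k * (0 - (t' + u))))
    (Num.min (dist0 (q k * (t - (t' + u)))) (dist0 (q k * (u - (t' + u)))))).
    by apply: jump => x; rewrite subr0 /arcs_parity; do 4!case: floor_odd.
  apply/funext => k; rewrite (_ : t - (t' + u) = t - t' - u); last by ring.
  by congr (Num.min _ (Num.min _ _)); apply: flip; ring.
split=> //.
apply: (@squeeze_cvgr _ _ _ _ (fun=> 0) (fun k => 3 * (m1 k + m2 k + m3 k + m4 k))).
- near=> k; rewrite le_min !dist0_ge0/=.
  have := dist0_min_sum_diff _ (q k * t) (q k * t') (q k * u).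
  by rewrite /= -!(mulrDr, mulrBr).
- exact: cvg_cst.
- have := cvgM (cvg_cst (3 : R)) (cvgD (cvgD (cvgD c1 c2) c3) c4).
  by rewrite !addr0 mulr0; exact.
Unshelve. all: by end_near. Qed.
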